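(* For all $a_1,\ldots,a_n\in\mathbb{Z}$, if there exists an $I\subseteq\{1,\ldots,n\}$ such that $\sum_{i\in I}a_i=0$, then for all $c\ge 1$ there exists $R=R(a_1,\ldots,a_n;c)$ such that for all $c$-colorings of $\{1,\ldots,R\}$ there exists a monochromatic solution to $a_1x_1+\cdots+a_nx_n=0$, where each $x_i\in\{1,\ldots,R\}$. Moreover, $R(a_1,\ldots,a_n;c)$ satisfies the following upper bound: $$R(a_1,a_2,\ldots,a_n;c)\le P\left(\frac{\mathrm{LCM}\left(\sum_{i\notin I}a_i,\,a_q\right)}{\sum_{i\notin I}a_i},\,-\frac{\mathrm{LCM}\left(\sum_{i\notin I}a_i,\,a_q\right)}{a_q},\,c\right).$$
   Context: The Rado number $R(a_1,\ldots,a_n;c)$ is the smallest $R$ such that for all $c$-colorings of $\{1,\ldots,R\}$ there exists a monochromatic solution to $a_1x_1+\cdots+a_nx_n=0$. For $c,l\in\mathbb{N}$ and a nonzero integer $m$, $P(l,m,c)$ denotes a natural number $P$ such that for all $c$-colorings of $\{1,\ldots,P\}$ there exist $a,d\in\mathbb{N}$ such that $a$, $ld$, $a+md$ all lie in $\{1,\ldots,P\}$ and have the same color (such a $P$ exists for all such $l,m,c$). In the bound, $q\in I$ is chosen so that $\left|\mathrm{LCM}\left(\sum_{i\notin I}a_i,\,a_q\right)\right|$ is minimal, and $\mathrm{LCM}\left(\sum_{i\notin I}a_i,\,a_q\right)$ is taken with the same sign as $\sum_{i\notin I}a_i$.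
   Formalization: I is required to contain an index with a nonzero coefficient (the claim fails for I empty, e.g. x_1 = 0, or for 0·x_1 + x_2 = 0 with I = {1}); q ranges over indices of I with a_q nonzero, and the bound is asserted only when the sum outside I is nonzero, since it is otherwise undefined. *)

(* Defs.v *)
From mathcomp Require Import all_boot all_order all_algebra.

Set Implicit Arguments.
Unset Strict Implicit.
Unset Printing Implicit Defensive.

Import Order.TTheory GRing.Theory Num.Theory.

Local Open Scope ring_scope.

(* A c-coloring of {1, ..., N} is given by a map chi : nat -> 'I_c of which
   only the values on {1, ..., N} are ever used; for c >= 1 every coloring of
   {1, ..., N} extends to such a map. *)

Definition mono_solution (n : nat) (a : 'I_n -> int) (N c : nat)
    (chi : nat -> 'I_c) : Prop :=
  exists x : 'I_n -> nat,
    [/\ forall i, (1 <= x i <= N)%N,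
        forall i j, chi (x i) = chi (x j)
      & \sum_i a i * (x i)%:Z = 0].

Definition rado_property (n : nat) (a : 'I_n -> int) (c N : nat) : Prop :=
  forall chi : nat -> 'I_c, mono_solution a N chi.

Definition is_rado_number (n : nat) (a : 'I_n -> int) (c R : nat) : Prop :=
  rado_property a c R /\ (forall N, rado_property a c N -> (R <= N)%N).

(* [P_property l m c P] says that P is an admissible value of P(l, m, c).
   The element a + m d is a natural number e, since it lies in {1, ..., P}. *)
Definition P_property (l : nat) (m : int) (c P : nat) : Prop :=
  forall chi : nat -> 'I_c,
  exists a d e : nat,
    [/\ (0 < d)%N,
        e%:Z = a%:Z + m * d%:Z,
        [/\ (1 <= a <= P)%N, (1 <= l * d <= P)%N & (1 <= e <= P)%N]
      & chi a = chi (l * d)%N /\ chi a = chi e].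

(* The least common multiple of s and t, with the sign of s. *)
Definition signed_lcm (s t : int) : int := sgz s * lcmz s t.

(* Main.v *)
(* If (y, l d, y + m d) is monochromatic, then x_q = y + m d, x_i = y for the
   other i in I and x_i = l d for i outside I solve the equation, since
   a_q m d + s l d = - L d + L d = 0.  Such triples exist by Brauer's argument:
   van der Waerden's theorem gives a long monochromatic progression of difference
   D; either some l D j has the same color, or the multiples of l D avoid that
   color and one concludes by induction on the number of colors. *)
Require Import Defs.
From mathcomp Require Import all_boot all_order all_algebra.
From mathcomp Require Import zify ring.
From Stdlib Require Import Classical.

Import Order.TTheory GRing.Theory Num.Theory.

Local Open Scope ring_scope.

Definition mono_progression {T : Type} (chi : nat -> T) (k a d : nat) : Prop :=
  forall i, (i <= k)%N -> chi (a + i * d)%N = chi a.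

(* Color focusing: the progressions in [s] have distinct colors, and all of them
   have [f] as their next term. *)
Definition focused {T : eqType} (chi : nat -> T) (k f : nat)
    (s : seq (nat * nat)) : Prop :=
  uniq [seq chi p.1 | p <- s] /\
  forall p, p \in s ->
    [/\ (0 < p.2)%N, (p.1 + k.+1 * p.2)%N = f & mono_progression chi k p.1 p.2].

(** The bound [N] also covers the term after the last one, where progressions focus. All finite [T]
    are allowed because color focusing takes whole windows as colors. *)
Definition van_der_waerden_for (k : nat) : Prop :=
  forall T : finType, exists N : nat, forall chi : nat -> T,
  exists a d : nat,
    [/\ (0 < d)%N, (a + k.+1 * d < N)%N & mono_progression chi k a d].

Lemma focusing (k : nat) (vdwk : van_der_waerden_for k) (T : finType) (r : nat) :
  exists N : nat, forall chi : nat -> T,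
    (exists a d : nat, [/\ (0 < d)%N, (a + k.+1 * d < N)%N
       & mono_progression chi k.+1 a d]) \/
    (exists f s, [/\ (f < N)%N, size s = r & focused chi k f s]).
Proof.
elim: r => [|r [N IHN]].
  by exists 1%N => chi; right; exists 0%N, [::].
(* Coloring [b] by the pattern of [chi] on the window of length [N] at [b] yields [k.+1] identical
   windows, at [A + i * D] for [i <= k]. *)
have [M HM] := vdwk {ffun 'I_N -> T}; exists (N + M)%N => chi.
have [A [D [D_gt0 ltM HW]]] := HM (fun b => [ffun i : 'I_N => chi (b + i)%N]).
have window i x : (i <= k)%N -> (x < N)%N ->
    chi (A + i * D + x)%N = chi (A + x)%N.
  by move=> lei ltx; move/ffunP/(_ (Ordinal ltx)): (HW i lei); rewrite !ffunE.
have extend a d : chi (A + (a + k.+1 * d))%N = chi (A + a)%N ->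
    mono_progression (fun x => chi (A + x)%N) k a d ->
    mono_progression chi k.+1 (A + a) d.
  move=> last mono i; rewrite leq_eqVlt => /orP[/eqP-> | lti].
    by rewrite -addnA.
  by rewrite -addnA; apply: mono.
case: (IHN (fun x => chi (A + x)%N)).
  move=> [a [d [d_gt0 lt mono]]]; left; exists (A + a)%N, d; split=> //.
    lia.
  by move=> i lei; rewrite -addnA; apply: mono.
move=> [f [s [ltf szs [uniq_s Hs]]]].
(* If the focus has the color of one of the progressions, that progression gains a term. *)
have [/mapP[[a d] /= ins eqc] | new] :=
    boolP (chi (A + f)%N \in [seq chi (A + p.1)%N | p <- s]).
  have [/= d_gt0 eqf mono] := Hs _ ins.
  left; exists (A + a)%N, d; split=> //; first lia.
  by apply: extend; rewrite ?eqf.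
have colorE (p : nat * nat) : p \in s -> forall i, (i <= k)%N ->
    chi (A + p.1 + i * (p.2 + D))%N = chi (A + p.1)%N.
  move=> ins i lei; have [p2_gt0 eqf mono] := Hs _ ins.
  have -> : (A + p.1 + i * (p.2 + D) = A + i * D + (p.1 + i * p.2))%N by lia.
  rewrite window //; first exact: mono.
  by apply: leq_ltn_trans ltf; rewrite -eqf leq_add2l leq_mul2r ltnW ?orbT.
(* Otherwise the copies of the old focus form a progression of a new color, and the old
   progressions, with [D] added to their differences, meet it at the focus shifted by [k.+1 * D]. *)
right; exists (A + f + k.+1 * D)%N.
exists ((A + f, D)%N :: [seq (A + p.1, p.2 + D)%N | p <- s]); split.
- lia.
- by rewrite /= size_map szs.
split; first by rewrite /= -map_comp; apply/andP; split.
move=> p; rewrite inE => /orP[/eqP-> /= | /mapP[p' ins -> /=]].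
  split=> // i lei.
  by rewrite addnAC window.
have [p2_gt0 eqf mono] := Hs _ ins; split; [lia | by rewrite -eqf mulnDr !addnA |].
exact: colorE.
Qed.

Lemma van_der_waerden (k : nat) : van_der_waerden_for k.
Proof.
elim: k => [|k IHk] T.
  exists 2%N => chi; exists 0%N, 1%N; split=> // i.
  by rewrite leqn0 => /eqP->.
(* [T] cannot supply [#|T|.+1] distinct colors. Since [d < N], the bound [N + N] leaves room for one
   further term. *)
have [N HN] := focusing k IHk T #|T|.+1; exists (N + N)%N => chi.
case: (HN chi) => [[a [d [d_gt0 lt mono]]] | [f [s [_ szs [uniq_s _]]]]].
  exists a, d; split=> //; lia.
have := max_card (mem [seq chi p.1 | p <- s]).
by rewrite (card_uniqP uniq_s) size_map szs ltnn.
Qed.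

(** The set [S] of permitted colors lets the induction remove a color while [T] stays fixed. *)
Lemma brauer_colors (l m : nat) (l_gt0 : (0 < l)%N) (T : finType) (r : nat) :
  exists Q : nat, forall (S : {set T}) (chi : nat -> T), (#|S| <= r)%N ->
    (forall x, (1 <= x <= Q)%N -> chi x \in S) ->
    exists a d : nat,
      [/\ (0 < a)%N, (0 < d)%N, (a + m * d <= Q)%N, (l * d <= Q)%N
        & chi a = chi (l * d)%N /\ chi a = chi (a + m * d)%N].
Proof.
elim: r => [|r [Q HQ]].
  exists 1%N => S chi; rewrite leqn0 cards_eq0 => /eqP-> /(_ 1%N isT).
  by rewrite inE.
(* With [m * Q] steps the progression contains [b.+1 + m * j * D] for all [j <= Q]. In the bound
   below, [l * N * Q] makes room for the multiples [l * D * x] with [x <= Q]. *)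
have [N HN] := van_der_waerden (m * Q) T.
exists (N + l * N * Q)%N => S chi leS inS.
have [b [D [D_gt0 ltN mono]]] := HN (fun x => chi x.+1).
have D_leN : (D <= N)%N by nia.
have mulD_le x : (x <= Q)%N -> (l * D * x <= l * N * Q)%N.
  by move=> lex; rewrite leq_mul // leq_mul.
have [[j [/andP[j_gt0 lej] eqj]] | avoid] :=
    classic (exists j, (1 <= j <= Q)%N /\ chi (l * D * j)%N = chi b.+1).
  have le_mj : (m * j <= m * Q)%N by rewrite leq_mul2l lej orbT.
  have le_mjD : (m * j * D <= m * Q * D)%N by rewrite leq_mul2r le_mj orbT.
  exists b.+1, (D * j)%N; split=> //.
  - by rewrite muln_gt0 D_gt0.
  - have -> : (b.+1 + m * (D * j) = (b + m * j * D).+1)%N by ring.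
    lia.
  - by rewrite mulnA; apply: leq_trans (mulD_le j lej) (leq_addl _ _).
  split; first by rewrite mulnA eqj.
  have -> : (b.+1 + m * (D * j) = (b + m * j * D).+1)%N by ring.
  by rewrite mono.
have rS : chi b.+1 \in S by apply: inS; lia.
(* The dilated coloring omits the color of [b.+1] on [1, ..., Q]; a triple for it, scaled by
   [l * D], is one for [chi]. *)
have [||a [d [a_gt0 d_gt0 lea led [eq1 eq2]]]] :=
    HQ (S :\ chi b.+1) (fun x => chi (l * D * x)%N).
- by move: leS; rewrite (cardsD1 (chi b.+1) S) rS.
- move=> x /andP[x_gt0 lex]; rewrite !inE; apply/andP; split.
    by apply/eqP => eqx; apply: avoid; exists x; rewrite x_gt0.
  apply: inS; rewrite !muln_gt0 l_gt0 D_gt0 x_gt0 /=.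
  by apply: leq_trans (mulD_le x lex) (leq_addl _ _).
have eA : (l * D * a + m * (l * D * d) = l * D * (a + m * d))%N by ring.
have eL : (l * (l * D * d) = l * D * (l * d))%N by ring.
exists (l * D * a)%N, (l * D * d)%N; rewrite eA eL !muln_gt0 l_gt0 D_gt0.
split=> //; exact: leq_trans (mulD_le _ _) (leq_addl _ _).
Qed.

Lemma P_property_exists (l : nat) (m : int) (c : nat) (l_gt0 : (0 < l)%N) :
  exists P : nat, P_property l m c P.
Proof.
have [Q HQ] := brauer_colors l `|m|%N l_gt0 'I_c c; exists Q => chi.
have [||a [d [a_gt0 d_gt0 lea led [eq1 eq2]]]] := HQ [set: 'I_c] chi.
- by rewrite cardsT card_ord.
- by move=> x _; rewrite inE.
have [m_ge0 | m_lt0] := lerP 0 m.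
  exists a, d, (a + `|m| * d)%N; split=> //; last by split; nia.
  by rewrite PoszD PoszM gez0_abs.
(* For negative [m] the two endpoints trade places. *)
exists (a + `|m| * d)%N, d, a; split=> //; last by rewrite -eq2.
  by rewrite PoszD PoszM ltz0_abs //; ring.
by split; nia.
Qed.

Lemma dvdz_signed_lcml (s t : int) : (s %| signed_lcm s t)%Z.
Proof. by rewrite dvdz_mull // dvdz_lcml. Qed.

Lemma dvdz_signed_lcmr (s t : int) : (t %| signed_lcm s t)%Z.
Proof. by rewrite dvdz_mull // dvdz_lcmr. Qed.

(** The signed lcm shares the sign of [s]. Hence taking the absolute value of this quotient, to get
    a natural number [l], leaves it unchanged. *)
Lemma signed_lcm_div_gt0 (s t : int) :
  s != 0 -> t != 0 -> 0 < (signed_lcm s t %/ s)%Z.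
Proof.
move=> s0 t0; have L0 : 0 < lcmz s t.
  by rewrite lt_neqAle lcmz_ge0 andbT eq_sym lcmz_neq0 s0.
have := divzK (dvdz_signed_lcml s t); rewrite /signed_lcm.
set k := (_ %/ s)%Z; case: sgzP s0 => // s_sign _; nia.
Qed.

Lemma rado_property_of_P (n : nat) (a : 'I_n -> int) (I : {set 'I_n})
    (hsum : \sum_(i in I) a i = 0) (q : 'I_n) (qI : q \in I) (aq0 : a q != 0)
    (c P : nat) :
  let s := \sum_(i | i \notin I) a i in
  s != 0 ->
  P_property `|(signed_lcm s (a q) %/ s)%Z|%N
             (- (signed_lcm s (a q) %/ a q)%Z) c P ->
  rado_property a c P.
Proof.
move=> s s0 HP chi; have [y [d [e [d_gt0 eE [ley led lee] [eq1 eq2]]]]] := HP chi.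
have sl := divzK (dvdz_signed_lcml s (a q)).
have tl := divzK (dvdz_signed_lcmr s (a q)).
have l_gt0 := signed_lcm_div_gt0 _ _ s0 aq0.
move: eq1 led eE sl tl l_gt0 {HP}.
set L := signed_lcm s (a q); set l := (L %/ s)%Z; set m := (L %/ a q)%Z.
move=> eq1 led eE sl tl l_gt0.
pose x i := if i \in I then if i == q then e else y else (`|l| * d)%N.
have chix i : chi (x i) = chi y by rewrite /x; case: ifP => // _; case: ifP.
exists x; split=> [i | i j |].
- by rewrite /x; case: ifP => // _; case: ifP.
- by rewrite !chix.
rewrite (bigID (fun i => i \in I)) /=.
have -> : \sum_(i | i \notin I) a i * (x i)%:Z = s * (l * d%:Z).
  rewrite mulr_suml; apply: eq_bigr => i /negbTE iI.
  by rewrite /x iI PoszM gtz0_abs.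
have -> : \sum_(i in I) a i * (x i)%:Z = a q * (e%:Z - y%:Z).
  (* Changing the value at [q] from [y] to [e] adds [a q * (e - y)] to a sum that vanishes. *)
  transitivity (\sum_(i in I) a i * y%:Z + a q * (e%:Z - y%:Z)).
    rewrite (bigD1 q) //= [in RHS](bigD1 q) //= /x qI eqxx.
    rewrite (eq_bigr (fun i => a i * y%:Z)); first by ring.
    by move=> i /andP[-> /negbTE->].
  by rewrite -mulr_suml hsum mul0r add0r.
rewrite eE.
(* Here [m] is [L / a q], so [e - y = - m * d], and both [l * s] and [m * a q] equal [L]. *)
transitivity (l * s * d%:Z - m * a q * d%:Z); first by ring.
by rewrite sl tl subrr.
Qed.

Lemma rado_number_exists (n : nat) (a : 'I_n -> int) (c N : nat) :
  rado_property a c N -> exists R, is_rado_number a c R.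
Proof.
elim/ltn_ind: N => N IHN radoN.
have [[M [ltMN radoM]] | minN] :=
    classic (exists M, (M < N)%N /\ rado_property a c M); first exact: IHN radoM.
exists N; split=> // M radoM; rewrite leqNgt; apply/negP => ltMN.
by apply: minN; exists M.
Qed.

(* The index set I contains an index with a nonzero coefficient: the statement
   fails for I empty and for 0 * x_1 + x_2 = 0 with I = {1}.  Accordingly, q is
   minimizing among the indices of I with nonzero coefficient.  The bound, whose
   first argument has denominator s, is asserted when s is nonzero; both
   quotients are then exact, and the first one is positive. *)
Theorem theorem4p5 (n : nat) (a : 'I_n -> int) (I : {set 'I_n})
    (hI : exists2 i, i \in I & a i != 0)
    (hsum : \sum_(i in I) a i = 0)
    (c : nat) (hc : (1 <= c)%N) :
  exists R : nat,
    is_rado_number a c R /\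
    let s := \sum_(i | i \notin I) a i in
    (s != 0 ->
     forall q : 'I_n, q \in I -> a q != 0 ->
       (forall q' : 'I_n, q' \in I -> a q' != 0 ->
          `|signed_lcm s (a q)| <= `|signed_lcm s (a q')|) ->
     forall P : nat,
       P_property `|(signed_lcm s (a q) %/ s)%Z|%N
                  (- (signed_lcm s (a q) %/ a q)%Z) c P ->
       (R <= P)%N).
Proof.
have [N radoN] : exists N, rado_property a c N.
  have [s0 | s0] := eqVneq (\sum_(i | i \notin I) a i) 0.
    (* All the coefficients together sum to 0, so the constant 1 is a solution. *)
    exists 1%N => chi; exists (fun=> 1%N); split=> //.
    rewrite (bigID (fun i => i \in I)) /= -!mulr_suml hsum s0.
    by rewrite !mul0r addr0.
  have [q qI aq0] := hI.
  have l_gt0 := signed_lcm_div_gt0 _ _ s0 aq0.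
  have [|P HP] := P_property_exists
    `|(signed_lcm (\sum_(i | i \notin I) a i) (a q)
         %/ \sum_(i | i \notin I) a i)%Z|%N
    (- (signed_lcm (\sum_(i | i \notin I) a i) (a q) %/ a q)%Z) c.
    by rewrite absz_gt0 gt_eqF.
  by exists P; apply: rado_property_of_P HP.
have [R radoR] := rado_number_exists n a c N radoN.
exists R; split=> // s s0 q qI aq0 _ P HP.
by apply: radoR.2; apply: rado_property_of_P HP.
Qed.
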